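(* There exists a universal constant $c>0$ such that for every $n\in\mathbb{N}$, $$ c\sqrt{n}\leq C_n\leq n,$$ where $$C_n=\sup\left\{\frac{\gamma_+(A)}{\|A\|_1}:A\in\mathbb{C}^{n\times n},\ A\succeq 0,\ A\neq 0\right\}.$$
   Context: For a self-adjoint positive semidefinite matrix $A\in\mathbb{C}^{n\times n}$, define $$\gamma_+(A):=\inf\left\{\sum_{k=1}^p\|x_k\|_1^2:\ p\in\mathbb{N},\ x_1,\ldots,x_p\in\mathbb{C}^n,\ \sum_{k=1}^p x_kx_k^*=A\right\},$$ where for a vector $x\in\mathbb{C}^n$, $\|x\|_1=\sum_i|x_i|$. For a matrix $A$, $\|A\|_1=\sum_{i,j}|A_{ij}|$ denotes the entrywise $1$-norm. $A\succeq 0$ means $A$ is self-adjoint positive semidefinite. *)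

(* Defs.v *)
From HB Require Import structures.
From mathcomp Require Import all_boot all_order all_algebra.
From mathcomp Require Import complex.
From mathcomp Require Import all_classical all_reals.
From mathcomp Require Import ereal.
From mathcomp Require Import Rstruct.
Set Implicit Arguments. Unset Strict Implicit. Unset Printing Implicit Defensive.
Import Order.TTheory GRing.Theory Num.Theory.
Local Open Scope ring_scope.
Local Open Scope complex_scope.

(* Complex numbers: C := R[i] over Stdlib's reals R (a realType). *)
Notation RR := Rdefinitions.R.
Notation CC := (RR[i]).

(* modulus |z| of a complex number, as a real number *)
Definition cabs (z : CC) : RR := Normc.normc z.

(* conjugate transpose M^* *)
Definition adjmx m n (M : 'M[CC]_(m, n)) : 'M[CC]_(n, m) :=
  map_mx (fun z : CC => z^*) M^T.

(* ||x||_1 = sum_i |x_i| for a vector x in C^n *)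
Definition vnorm1 n (x : 'cV[CC]_n) : RR := \sum_(i < n) cabs (x i ord0).

(* ||A||_1 = sum_{i,j} |A_ij| (entrywise 1-norm) *)
Definition mnorm1 n (A : 'M[CC]_n) : RR := \sum_(i < n) \sum_(j < n) cabs (A i j).

(* A is self-adjoint positive semidefinite *)
Definition psd n (A : 'M[CC]_n) : Prop :=
  A = adjmx A /\ forall x : 'cV[CC]_n, 0 <= (adjmx x *m A *m x) ord0 ord0.

(* the set of values sum_k ||x_k||_1^2 over decompositions A = sum_k x_k x_k^* *)
Definition gamma_set n (A : 'M[CC]_n) : set RR :=
  [set t | exists (p : nat) (x : 'I_p -> 'cV[CC]_n),
      \sum_(k < p) (x k *m adjmx (x k)) = A /\
      t = \sum_(k < p) (vnorm1 (x k)) ^+ 2].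

(* gamma_+(A) = infimum of that set *)
Definition gamma_plus n (A : 'M[CC]_n) : RR := inf (gamma_set A).

(* C_n = sup { gamma_+(A)/||A||_1 : A psd, A <> 0 }, taken in the extended reals *)
Definition Cn (n : nat) : \bar RR :=
  ereal_sup [set ((gamma_plus A / mnorm1 A)%:E) | A in [set A : 'M[CC]_n | psd A /\ A <> 0]].

(* Main.v *)
(** Upper bound: if [A = sum_k x_k x_k^*] then, by Cauchy-Schwarz,
    [sum_k |x_k|_1^2 <= n sum_k |x_k|_2^2 = n tr A <= n |A|_1].

    Lower bound: take [A = G G^T] for an [n x m^2] sign matrix [G], with [m^2] of
    order [n], such that [|G y|_1 >= c n |y|_2] for all [y] (a Kashin-type section of
    [l_1^n]).  The vectors of any decomposition of [A] lie in the range of [G], say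
    [x_k = G y_k], and then [sum_k y_k y_k^* = I], so that
    [sum_k |x_k|_1^2 >= c^2 n^2 sum_k |y_k|_2^2 = c^2 n^2 m^2] (up to a factor 2 for
    complex [y_k]).  Moreover [|G w|_1 <= 4 n m] for all [w] in the cube [[-1, 1]^(m^2)];
    as the rows of [G] lie in that cube, [|A|_1 <= 4 n^2 m], and the quotient is at least
    of order [m].

    Such a [G] exists by a first-moment argument over all sign matrices: an exponential
    test function controls [|G w|_1] at the vertices [w] of the cube, and the test
    function [1 / (1 + |x| / 4)], whose mean is bounded through the second and fourth
    moments, gives the lower bound at the integer points [z] with [|z|_1 <= 78 m^2].
    A general [y] is rescaled and rounded to such a point; the rounding error lies in
    the cube. *)

Require Import Defs.
From HB Require Import structures.
From mathcomp Require Import all_boot all_order all_algebra.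
From mathcomp Require Import complex.
From mathcomp Require Import all_classical all_reals.
From mathcomp Require Import ereal.
From mathcomp Require Import Rstruct.
From mathcomp Require Import sequences exp ring lra zify.
Import Order.TTheory GRing.Theory Num.Theory.
Local Open Scope ring_scope.

(** * Random sign vectors *)

Section SignRows.
Variables (R : realType) (d : nat).
Local Notation row := {ffun 'I_d -> bool}.
Implicit Types (r w : row) (v : 'I_d -> R).

Definition sdot r v : R := \sum_j (-1) ^+ r j * v j.

Definition sgn_vec w (j : 'I_d) : R := (-1) ^+ w j.

Definition flip (j : 'I_d) r : row := [ffun k => r k (+) (k == j)].

Lemma sum_flip (j : 'I_d) (F : row -> R) : \sum_r F r = \sum_r F (flip j r).
Proof.
apply: (reindex_inj (h := flip j)) => r r' /ffunP e; apply/ffunP => k.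
by move: (e k); rewrite !ffunE => /addIb.
Qed.

Lemma flip_partial (j : 'I_d) (s : seq 'I_d) r v : j \notin s ->
  \sum_(k <- s) (-1) ^+ (flip j r k) * v k = \sum_(k <- s) (-1) ^+ r k * v k.
Proof.
move=> js; apply: eq_big_seq => k ks; rewrite ffunE.
by case: eqP ks => [->|_ _]; rewrite ?addbF// (negPf js).
Qed.

(** Pairing each [r] with [flip j r] averages over the sign at [j], which does not enter the sum
    over [s]. *)
Lemma sum_sdot_cons (p : nat) (j : 'I_d) (s : seq 'I_d) v : j \notin s ->
  \sum_(r : row) (\sum_(k <- j :: s) (-1) ^+ r k * v k) ^+ p =
  2^-1 * \sum_(r : row) ((\sum_(k <- s) (-1) ^+ r k * v k + v j) ^+ p
                 + (\sum_(k <- s) (-1) ^+ r k * v k - v j) ^+ p).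
Proof.
move=> js; set F := fun r => (\sum_(k <- j :: s) (-1) ^+ r k * v k) ^+ p.
have e : \sum_r F r = 2^-1 * (\sum_(r : row) (F r + F (flip j r))).
  by rewrite big_split /= -(sum_flip j F); field.
rewrite e; congr (_ * _); apply: eq_bigr => r _.
rewrite /F !big_cons flip_partial// ffunE eqxx addbT.
case: (r j); rewrite /= ?expr0 ?expr1 ?mulN1r ?mul1r.
  by rewrite addrC; congr (_ ^+ _ + _ ^+ _); rewrite addrC.
by congr (_ ^+ _ + _ ^+ _); rewrite addrC.
Qed.

Lemma sum_sdot_sqr (s : seq 'I_d) v : uniq s ->
  \sum_(r : row) (\sum_(k <- s) (-1) ^+ r k * v k) ^+ 2 =
  2 ^+ d * \sum_(k <- s) v k ^+ 2.
Proof.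
elim: s => [_|j s IH /= /andP[js us]].
  by rewrite big_nil mulr0 big1// => r _; rewrite big_nil expr0n.
rewrite sum_sdot_cons// big_cons mulrDr -IH//.
rewrite (eq_bigr (fun r : row =>
  2 * ((\sum_(k <- s) (-1) ^+ r k * v k) ^+ 2 + v j ^+ 2)));
  last by move=> r _; ring.
rewrite -mulr_sumr big_split /= sumr_const card_ffun card_bool card_ord.
by rewrite -[v j ^+ 2 *+ _]mulr_natl natrX; field.
Qed.

(** Khintchine's fourth moment: averaging over the new sign turns [Y^4] into
    [Y^4 + 6 v^2 Y^2 + v^4], and [3 S^2 + 6 v^2 S + v^4 <= 3 (S + v^2)^2]. *)
Lemma sum_sdot_pow4 (s : seq 'I_d) v : uniq s ->
  \sum_(r : row) (\sum_(k <- s) (-1) ^+ r k * v k) ^+ 4 <=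
  3 * 2 ^+ d * (\sum_(k <- s) v k ^+ 2) ^+ 2.
Proof.
elim: s => [_|j s IH /= /andP[js us]].
  by rewrite big_nil expr0n mulr0 big1// => r _; rewrite big_nil expr0n.
rewrite sum_sdot_cons//.
set Y := fun r => \sum_(k <- s) (-1) ^+ r k * v k.
rewrite (eq_bigr (fun r => 2 * (Y r ^+ 4 + 6 * v j ^+ 2 * Y r ^+ 2 + v j ^+ 4)));
  last by move=> r _; rewrite -/(Y r); ring.
rewrite -mulr_sumr mulKf// 2!big_split /= -mulr_sumr sum_sdot_sqr//.
rewrite sumr_const card_ffun card_bool card_ord -[_ *+ (2 ^ d)]mulr_natl natrX big_cons.
move: (IH us); rewrite -/Y; set S := \sum_(k <- s) _; set D : R := 2 ^+ d.
have D0 : 0 <= D * v j ^+ 4 by apply: mulr_ge0; [exact: exprn_ge0 | exact: exprn_even_ge0].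
by move=> h; nra.
Qed.

(** A majorant in [x^2] and [x^4] only, whose mean is controlled by moments: with second moment [1]
    and fourth at most [3] it gives [1 - 3/16 + 3/24 = 15/16]. *)
Lemma inv1D_le (x : R) : (1 + `|x| / 4)^-1 <= 1 - 3 / 16 * x ^+ 2 + x ^+ 4 / 24.
Proof.
have -> : x ^+ 4 = (`|x| ^+ 2) ^+ 2 by rewrite real_normK ?num_real// -exprM.
rewrite -[x ^+ 2](@real_normK _ x) ?num_real//.
move: `|x| (normr_ge0 x) => t t0.
have h1 : (1 + t / 4)^-1 <= 1 - t / 4 + t ^+ 2 / 16.
  rewrite -[_^-1]mul1r ler_pdivrMr; last by lra.
  have : 0 <= t ^+ 3 by rewrite exprn_ge0.
  by move=> h; nra.
(* [71/50] approximates [sqrt 2], the minimiser of [1 - t + t^3/6] on [t >= 0]. *)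
have h2 : 0 <= 1 - t + t ^+ 3 / 6.
  have : 0 <= (t - 71 / 50) ^+ 2 * (t + 71 / 25) by rewrite mulr_ge0 ?sqr_ge0//; lra.
  by move=> h; nra.
(* A quarter of this is the gap between the quadratic of [h1] and the quartic. *)
have h3 : 0 <= t * (1 - t + t ^+ 3 / 6) by rewrite mulr_ge0.
by nra.
Qed.

Lemma sum_inv_sdot v : \sum_j v j ^+ 2 = 1 ->
  \sum_(r : row) (1 + `|sdot r v| / 4)^-1 <= 15 / 16 * 2 ^+ d.
Proof.
move=> v1; apply: (@le_trans _ _ (\sum_(r : row) (1 - 3 / 16 * sdot r v ^+ 2 + sdot r v ^+ 4 / 24))).
  by apply: ler_sum => r _; exact: inv1D_le.
rewrite 2!big_split /= sumrN -mulr_sumr -mulr_suml sumr_const card_ffun card_bool card_ord.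
have u := index_enum_uniq 'I_d.
have := sum_sdot_pow4 _ v u; rewrite sum_sdot_sqr// v1 natrX.
by move=> h; lra.
Qed.

Lemma sum_expR_sdot (t : R) v :
  \sum_(r : row) expR (t * sdot r v) = \prod_j (expR (t * v j) + expR (- (t * v j))).
Proof.
rewrite (eq_bigr (fun j => \sum_(b : bool) expR (t * ((-1) ^+ b * v j)))); last first.
  by move=> j _; rewrite big_bool /= expr1 expr0 mulN1r mul1r mulrN addrC.
rewrite bigA_distr_bigA; apply: eq_bigr => r _.
by rewrite /sdot mulr_sumr expR_sum.
Qed.

(** [exp (t |x|) <= exp (t x) + exp (- t x)], and the factors of the moment generating function do
    not change with the signs in [w]. *)
Lemma sum_expR_norm_sdot (t : R) w : 0 <= t ->
  \sum_(r : row) expR (t * `|sdot r (sgn_vec w)|)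
  <= 2 * (expR t + expR (- t)) ^+ d.
Proof.
move=> t0; set v := sgn_vec w.
apply: (@le_trans _ _ (\sum_(r : row) (expR (t * sdot r v) + expR (- t * sdot r v)))).
  apply: ler_sum => r _; rewrite mulNr.
  have := expR_ge0 (t * sdot r v); have := expR_ge0 (- (t * sdot r v)).
  by case: (ger0P (sdot r v)) => _ h1 h2; rewrite ?mulrN; lra.
rewrite big_split /= !sum_expR_sdot.
have e (u : R) : \prod_j (expR (u * v j) + expR (- (u * v j))) = (expR u + expR (- u)) ^+ d.
  rewrite -[d in RHS]card_ord -prodr_const; apply: eq_bigr => j _; rewrite /v /sgn_vec.
  by case: (w j); rewrite /= ?expr1 ?expr0 ?mulrN1 ?mulr1 ?opprK// addrC.
rewrite !e opprK [expR (- t) + _]addrC; lra.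
Qed.

End SignRows.

Arguments sdot {R d} r v.
Arguments sgn_vec R {d} w j.

(** * Independence of rows and elementary inequalities *)

Lemma sum_prod_ffun (R : comNzRingType) (T : finType) (n : nat) (h : T -> R) :
  \sum_(G : {ffun 'I_n -> T}) \prod_i h (G i) = (\sum_r h r) ^+ n.
Proof.
by rewrite -(bigA_distr_bigA (fun (_ : 'I_n) r => h r)) prodr_const card_ord.
Qed.

(** With [x = 1/(2d)], Bernoulli gives [(1 - x)^d >= 1/2], while [(1 + x)^d (1 - x)^d <= 1]. *)
Lemma expR1D_le2 (R : realType) (d : nat) : (0 < d)%N ->
  (1 + (2 * d%:R)^-1 : R) ^+ d <= 2.
Proof.
move=> d0; set x : R := (2 * d%:R)^-1.
have dp : 0 < d%:R :> R by rewrite ltr0n.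
have x0 : 0 < x by rewrite invr_gt0 mulr_gt0.
have xd : x * d%:R = 2^-1 by rewrite /x; field; lra.
have d1 : 1 <= d%:R :> R by rewrite ler1n.
have x1 : x <= 2^-1 by rewrite -xd ler_peMr// ltW.
have B : forall k : nat, 1 - x * k%:R <= (1 - x) ^+ k.
  elim=> [|k IH]; first by rewrite mulr0 subr0.
  rewrite exprS -natr1.
  have : (1 - x) * (1 - x * k%:R) <= (1 - x) * (1 - x) ^+ k by rewrite ler_wpM2l//; lra.
  have : 0 <= x * x * k%:R by rewrite !mulr_ge0// ltW.
  by move=> *; lra.
have := B d; rewrite xd => Bd.
have p : (1 + x) ^+ d * (1 - x) ^+ d <= 1.
  by rewrite -exprMn exprn_ile1//; nra.
have q : 0 <= (1 + x) ^+ d by rewrite exprn_ge0//; lra.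
by nra.
Qed.

Lemma ler_bernoulli (R : realDomainType) (x : R) (k : nat) : 0 <= x ->
  1 + x * k%:R <= (1 + x) ^+ k.
Proof.
move=> x0; elim: k => [|k IH]; first by rewrite mulr0 addr0.
rewrite exprS -natr1.
have : (1 + x) * (1 + x * k%:R) <= (1 + x) * (1 + x) ^+ k.
  by rewrite ler_wpM2l// addr_ge0.
have : 0 <= x * x * k%:R by rewrite !mulr_ge0.
by move=> *; nra.
Qed.

(** AM-GM for the numbers [1 + t i]. *)
Lemma prod1D_le (R : realFieldType) (n : nat) (t : 'I_n -> R) (c : R) :
  (forall i, 0 <= t i) -> \sum_i t i <= n%:R * c -> \prod_i (1 + t i) <= (1 + c) ^+ n.
Proof.
case: n t => [|n] t t0 tc; first by rewrite big_ord0.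
have n0 : 0 < n.+1%:R :> R by rewrite ltr0n.
have u0 i : 0 <= 1 + t i by rewrite addr_ge0.
have [+ _] := @leif_AGM R 'I_n.+1 predT (fun i => 1 + t i) (fun i _ => u0 i).
rewrite cardT size_enum_ord => /le_trans; apply.
have e : \sum_(i in 'I_n.+1) (1 + t i) = n.+1%:R + \sum_i t i.
  by rewrite big_split /= sumr_const card_ord.
rewrite lerXn2r ?nnegrE ?e ?divr_ge0 ?addr_ge0 ?sumr_ge0 ?ler0n//.
  have := le_trans (sumr_ge0 _ (fun i _ => t0 i)) tc.
  by rewrite pmulr_rge0// => ?; rewrite addr_ge0.
by rewrite ler_pdivrMr//; lra.
Qed.


(** * A Kashin-type sign matrix *)

Section Existence.
Variables (R : realType) (n m : nat).
(* [2511 = 31 * 81]: [(31/30)^31 >= 2], and [2^(81 d)] beats the [2^N * 4^d] lattice points. *)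
Hypotheses (m_gt0 : (0 < m)%N) (n_ge : (2511 * m ^ 2 <= n)%N).
Let d := (m ^ 2)%N.
Let N := (78 * d)%N.
Local Notation row := {ffun 'I_d -> bool}.
Local Notation lattice := {ffun 'I_d -> bool * 'I_N.+1}.

(* An integer vector given by signs and absolute values, so that [0] has several codes;
   only an upper bound on their number is needed. *)
Definition lattice_vec (z : lattice) (j : 'I_d) : R := (-1) ^+ (z j).1 * ((z j).2)%:R.

Let nrm2 (z : lattice) : R := \sum_j lattice_vec z j ^+ 2.
Let unit_vec (z : lattice) (j : 'I_d) : R := lattice_vec z j / Num.sqrt (nrm2 z).
(** Of order [1/m], the inverse of the typical size [sqrt d = m] of a signed sum of [d] signs. *)
Let theta : R := ln (1 + m%:R^-1).

Let d_gt0 : (0 < d)%N. Proof. by rewrite expn_gt0 m_gt0. Qed.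
Let mR_gt0 : 0 < m%:R :> R. Proof. by rewrite ltr0n. Qed.
Let mV_gt0 : 0 < m%:R^-1 :> R. Proof. by rewrite invr_gt0. Qed.

Let expR_theta : expR theta = 1 + m%:R^-1.
Proof. by rewrite lnK// posrE; have := mV_gt0; lra. Qed.

Let theta_ge0 : 0 <= theta.
Proof. by rewrite ln_ge0//; have := mV_gt0; lra. Qed.

(** Here [exp theta + exp (- theta) <= 2 (1 + 1/(2d))], whose [d]-th power is at most [2 * 2^d]. *)
Lemma row_upper (w : row) :
  \sum_(r : row) expR (theta * `|sdot r (sgn_vec R w)|) <= 4 * 2 ^+ d.
Proof.
apply: le_trans (sum_expR_norm_sdot R d theta w theta_ge0) _.
rewrite expRN expR_theta.
have h : (1 + m%:R^-1) + (1 + m%:R^-1)^-1 <= 2 * (1 + (2 * d%:R)^-1) :> R.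
  have -> : (2 * d%:R)^-1 = m%:R^-1 ^+ 2 / 2 :> R.
    by rewrite natrX; field; rewrite gt_eqF.
  move: (m%:R^-1) mV_gt0 => x x0.
  rewrite -subr_ge0.
  have -> : 2 * (1 + x ^+ 2 / 2) - (1 + x + (1 + x)^-1) = x ^+ 3 / (1 + x).
    by field; lra.
  by rewrite divr_ge0// ?exprn_ge0 ?ltW//; lra.
have : ((1 + m%:R^-1) + (1 + m%:R^-1)^-1) ^+ d <= (2 * (1 + (2 * d%:R)^-1)) ^+ d :> R.
  by rewrite lerXn2r ?nnegrE.
have := @expR1D_le2 R d d_gt0; rewrite exprMn.
have : 0 < 2 ^+ d :> R by rewrite exprn_gt0.
move: (2 ^+ d : R) => D D0 h1 h2; nra.
Qed.

Lemma row_lower (z : lattice) : 0 < nrm2 z ->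
  \sum_(r : row) (1 + `|sdot r (unit_vec z)| / 4)^-1 <= 15 / 16 * 2 ^+ d.
Proof.
move=> z0; apply: sum_inv_sdot.
under eq_bigr => j _ do rewrite /unit_vec expr_div_n sqr_sqrtr ?(ltW z0)//.
by rewrite -mulr_suml -/(nrm2 z) divff// gt_eqF.
Qed.

(* Each integer point with [|z|_1 <= N] has weight at least [1]. *)
Lemma lattice_count :
  \sum_(z : lattice) 2 ^+ N / 2 ^+ (\sum_j (z j).2) <= 2 ^+ N * 4 ^+ d :> R.
Proof.
rewrite -mulr_sumr ler_wpM2l ?exprn_ge0//.
rewrite (eq_bigr (fun z : lattice => \prod_j (2^-1) ^+ (z j).2)); last first.
  by move=> z _; rewrite prodrXr exprVn.
rewrite -(bigA_distr_bigA (fun (_ : 'I_d) (b : bool * 'I_N.+1) => 2^-1 ^+ b.2 : R)).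
rewrite prodr_const card_ord lerXn2r ?nnegrE ?sumr_ge0//.
rewrite -(pair_bigA _ (fun (b : bool) (k : 'I_N.+1) => 2^-1 ^+ k)) /=.
rewrite big_bool /=.
have e k : \sum_(i < k) 2^-1 ^+ i = 2 - 2 * 2^-1 ^+ k :> R.
  elim: k => [|k IH]; first by rewrite big_ord0 expr0; lra.
  by rewrite big_ord_recr /= IH exprS; lra.
rewrite e; have : 0 <= 2^-1 ^+ N.+1 :> R by rewrite exprn_ge0.
by lra.
Qed.

(** Normalised to be at least 1 when the upper bound fails at [w], since
    [(1 + 1/m)^(4nm) >= 2^(4n)]. *)
Let upper_test (G : {ffun 'I_n -> row}) (w : row) : R :=
  (2 ^+ (4 * n))^-1 * \prod_i expR (theta * `|sdot (G i) (sgn_vec R w)|).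
(** At least 1 when the lower bound fails at a [z] with [|z|_1 <= N]: AM-GM then bounds the product
    of the [1 + |.|/4] by [(32/31)^n]. Its mean decays like [(30/31)^n], as
    [32/31 * 15/16 = 30/31]. *)
Let lower_test (G : {ffun 'I_n -> row}) (z : lattice) : R :=
  2 ^+ N / 2 ^+ (\sum_j (z j).2) * (32 / 31) ^+ n
  * \prod_i (1 + `|sdot (G i) (unit_vec z)| / 4)^-1.

(** On average the [2^d] vertices contribute at most [2^d 4^(-n) <= 2^(-n)], and the lattice points
    at most [2^(80 d) (30/31)^n <= 1/2]. *)
Let first_moment :
  \sum_G (\sum_w upper_test G w + \sum_(z | 0 < nrm2 z) lower_test G z)
  < #|{ffun 'I_n -> row}|%:R.
Proof.
rewrite big_split /= exchange_big /= [X in _ + X]exchange_big /=.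
set D : R := (2 ^+ d) ^+ n.
have D0 : 0 < D by rewrite !exprn_gt0.
have -> : #|{ffun 'I_n -> row}|%:R = D by rewrite !card_ffun card_bool !card_ord !natrX.
have U : \sum_w \sum_G upper_test G w <= D * (2 ^+ n)^-1.
  apply: (@le_trans _ _ (\sum_(w : row) D * (2 ^+ (2 * n))^-1)).
    apply: ler_sum => w _; rewrite -mulr_sumr.
    rewrite (sum_prod_ffun _ _ n (fun r => expR (theta * `|sdot r (sgn_vec R w)|))).
    rewrite ler_pdivrMl ?exprn_gt0//.
    have -> : 2 ^+ (4 * n) * (D / 2 ^+ (2 * n)) = (4 * 2 ^+ d) ^+ n :> R.
      rewrite exprMn -/D (_ : 4 = 2 ^+ 2 :> R); last by ring.
      rewrite -exprM (_ : (4 * n)%N = (2 * n + 2 * n)%N); last by lia.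
      rewrite exprD; field; by rewrite expf_neq0.
    by rewrite lerXn2r ?nnegrE ?sumr_ge0 ?row_upper// => *; rewrite ?expR_ge0// mulr_ge0 ?exprn_ge0.
  rewrite sumr_const card_ffun card_bool card_ord -[_ *+ (2 ^ d)]mulr_natl natrX.
  rewrite (_ : (2 * n)%N = (n + n)%N); last by lia.
  rewrite exprD invfM mulrCA ler_pM2l// mulrA ler_piMl// ?invr_ge0 ?exprn_ge0//.
  rewrite ler_pdivrMr ?exprn_gt0// mul1r ler_eXn2l// ?ltr1n//.
  by rewrite (leq_trans _ n_ge)// leq_pmull.
have L : \sum_(z | 0 < nrm2 z) \sum_G lower_test G z <= D / 2.
  apply: (@le_trans _ _ (\sum_(z : lattice) 2 ^+ N / 2 ^+ (\sum_j (z j).2) * ((30 / 31) ^+ n * D))).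
    rewrite [leRHS](bigID (fun z => 0 < nrm2 z)) /= -[leLHS]addr0 lerD//; last first.
      by apply: sumr_ge0 => *; rewrite !mulr_ge0// ?invr_ge0 ?exprn_ge0.
    apply: ler_sum => z z0; rewrite -mulr_sumr.
    rewrite (sum_prod_ffun _ _ n (fun r => (1 + `|sdot r (unit_vec z)| / 4)^-1)) -[leLHS]mulrA.
    rewrite ler_wpM2l ?divr_ge0 ?exprn_ge0// -!exprMn.
    rewrite lerXn2r ?nnegrE ?mulr_ge0 ?sumr_ge0 ?exprn_ge0//.
    have := row_lower z z0.
    by move: (\sum_r _) (2 ^+ d : R) => a b; lra.
  rewrite -mulr_suml.
  apply: (@le_trans _ _ (2 ^+ N * 4 ^+ d * ((30 / 31) ^+ n * D))).
    by rewrite ler_wpM2r ?lattice_count// mulr_ge0 ?exprn_ge0 ?ltW.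
  rewrite mulrA [leRHS]mulrC ler_pM2r//.
  have B : 2 <= (31 / 30) ^+ 31 :> R.
    have := @ler_bernoulli R (1 / 30) 31 ltac:(lra).
    by rewrite (_ : 1 + 1 / 30 = 31 / 30); [lra|field].
  have C : 2 ^+ (81 * d) <= (31 / 30) ^+ n :> R.
    apply: (@le_trans _ _ ((31 / 30) ^+ (31 * (81 * d)))).
      by rewrite [leRHS]exprM lerXn2r ?nnegrE// (le_trans _ B).
    rewrite ler_eXn2l; [|lra].
    by apply: leq_trans n_ge; rewrite mulnA.
  have -> : 30 / 31 = (31 / 30)^-1 :> R by field.
  rewrite exprVn ler_pdivrMr; last by rewrite exprn_gt0//; lra.
  rewrite (_ : 4 = 2 ^+ 2 :> R); last by ring.
  rewrite -exprM -exprD; apply: (@le_trans _ _ (2^-1 * 2 ^+ (81 * d))); last first.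
    by rewrite ler_pM2l.
  rewrite -ler_pdivrMl// invrK -exprS ler_eXn2l ?ltr1n//.
  rewrite /N; lia.
apply: le_lt_trans (lerD U L) _.
have : (2 ^+ n)^-1 < 2^-1 :> R.
  rewrite ltf_pV2 ?posrE ?exprn_gt0// -[ltLHS]expr1 ltr_eXn2l ?ltr1n//.
  by apply: leq_trans n_ge; lia.
by move=> h; rewrite -subr_gt0; nra.
Qed.

(** Some [G] has total test value below 1; all tests being nonnegative, each is below 1, so no bound
    fails. *)
Lemma exists_sign_rows : exists G : {ffun 'I_n -> row},
  (forall w : row, \sum_i `|sdot (G i) (sgn_vec R w)| <= 4 * n%:R * m%:R) /\
  (forall z : lattice, (\sum_j (z j).2 <= N)%N ->
     4 / 31 * n%:R * Num.sqrt (\sum_j lattice_vec z j ^+ 2) <= \sum_i `|sdot (G i) (lattice_vec z)|).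
Proof.
have U0 G w : 0 <= upper_test G w.
  by rewrite mulr_ge0 ?invr_ge0 ?exprn_ge0 ?prodr_ge0// => i _; exact: expR_ge0.
have L0 G z : 0 <= lower_test G z.
  by rewrite !mulr_ge0 ?invr_ge0 ?exprn_ge0 ?prodr_ge0// => i _; rewrite invr_ge0.
have [G Glt] : exists G, \sum_w upper_test G w + \sum_(z | 0 < nrm2 z) lower_test G z < 1.
  apply: contrapT => /forallNP H; have := first_moment; rewrite ltNge => /negP; apply.
  rewrite -sum1_card natr_sum; apply: ler_sum => G _.
  by rewrite leNgt; apply/negP/H.
exists G; split=> [w|z zN].
- rewrite leNgt; apply/negP => lt.
  have : upper_test G w < 1.
    apply: le_lt_trans Glt; rewrite (bigD1 w)//= -addrA lerDl addr_ge0// sumr_ge0// => *.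
  rewrite ltNge => /negP; apply.
  rewrite /upper_test -expR_sum -mulr_sumr ler_pdivlMl ?exprn_gt0// mulr1.
  apply: (@le_trans _ _ (expR (theta * (4 * n%:R * m%:R)))); last first.
    by rewrite ler_expR ler_wpM2l// ltW.
  rewrite -!natrM expRM_natr expR_theta [(4 * n * m)%N]mulnC [leRHS]exprM lerXn2r ?nnegrE//.
  apply: le_trans (ler_bernoulli _ _ m (ltW mV_gt0)).
  by rewrite mulVf ?gt_eqF//; lra.
- have [z0|] := ltP 0 (nrm2 z); last first.
    by move=> /ler0_sqrtr; rewrite /nrm2 => ->; rewrite mulr0 sumr_ge0.
  have s0 : 0 < Num.sqrt (nrm2 z) by rewrite sqrtr_gt0.
  have e i : `|sdot (G i) (lattice_vec z)| = Num.sqrt (nrm2 z) * `|sdot (G i) (unit_vec z)|.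
    rewrite -{1}(gtr0_norm s0) -normrM; congr `|_|.
    rewrite /sdot mulr_sumr; apply: eq_bigr => j _; rewrite /unit_vec.
    by field; rewrite gt_eqF.
  rewrite [leRHS](eq_bigr _ (fun i _ => e i)).
  rewrite -mulr_sumr -/(nrm2 z) mulrC ler_pM2l// leNgt; apply/negP => lt.
  have : lower_test G z < 1.
    apply: le_lt_trans Glt; rewrite [X in _ + X](bigD1 z)//= addrCA lerDl addr_ge0// sumr_ge0// => *.
  rewrite ltNge => /negP; apply.
  rewrite /lower_test prodfV -mulrA.
  have P0 : 0 < \prod_i (1 + `|sdot (G i) (unit_vec z)| / 4).
    by apply: prodr_gt0 => i _; rewrite ltr_pwDl// divr_ge0.
  have a1 : 1 <= 2 ^+ N / 2 ^+ (\sum_j (z j).2) :> R.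
    by rewrite ler_pdivlMr ?exprn_gt0// mul1r ler_eXn2l// ltr1n.
  apply: le_trans a1 _; rewrite ler_peMr//.
  rewrite ler_pdivlMr// mul1r.
  rewrite (_ : 32 / 31 = 1 + 1 / 31); last by field.
  apply: prod1D_le => [i|]; first by rewrite divr_ge0.
  by rewrite -mulr_suml; lra.
Qed.

End Existence.

(** * From integer points to all real vectors *)

Section Cube.
Variables (R : realType) (n d : nat).
Implicit Types (v y u : 'I_d -> R).

Lemma sdotZ (r : {ffun 'I_d -> bool}) (a : R) v :
  sdot r (fun j => a * v j) = a * sdot r v.
Proof. by rewrite /sdot mulr_sumr; apply: eq_bigr => j _; rewrite mulrCA. Qed.

Lemma sdotB (r : {ffun 'I_d -> bool}) u v :
  sdot r (fun j => u j - v j) = sdot r u - sdot r v.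
Proof. by rewrite /sdot -sumrB; apply: eq_bigr => j _; rewrite mulrBr. Qed.

(* The left-hand side is convex in [u], hence maximal at a vertex of the cube. *)
Lemma sdot_cube (G : 'I_n -> {ffun 'I_d -> bool}) (M : R) :
  (forall w, \sum_i `|sdot (G i) (sgn_vec R w)| <= M) ->
  forall u, (forall j, `|u j| <= 1) -> \sum_i `|sdot (G i) u| <= M.
Proof.
move=> GM u u1.
(* Freezing the signs of [G u] makes the sum linear in [u], with coefficients [c]; the signs of [c]
   give the maximising vertex [w]. *)
pose s i : R := (-1) ^+ (sdot (G i) u < 0)%R.
pose c j : R := \sum_i s i * (-1) ^+ G i j.
have swap v : \sum_i s i * sdot (G i) v = \sum_j c j * v j.
  under eq_bigr => i _ do rewrite mulr_sumr.
  rewrite exchange_big; apply: eq_bigr => j _; rewrite mulr_suml.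
  by apply: eq_bigr => i _; rewrite mulrA.
under eq_bigr => i _ do rewrite normrEsign -/(s i).
pose w := [ffun j => (c j < 0)%R].
apply: le_trans (GM w); rewrite swap.
apply: (@le_trans _ _ (\sum_j c j * sgn_vec R w j)).
  apply: ler_sum => j _; rewrite /sgn_vec ffunE [leRHS]mulrC -normrEsign.
  by rewrite (le_trans (ler_norm _))// normrM ler_piMr.
rewrite -swap; apply: ler_sum => i _.
by rewrite (le_trans (ler_norm _))// normrM normrX normrN1 expr1n mul1r.
Qed.

End Cube.

(** For [m = 1], which serves small [n], the all-ones column works. Otherwise [y] is rescaled to
    length [78 m] and truncated toward zero. *)
Lemma exists_sign_section (R : realType) (n m : nat) : (0 < m)%N ->
  (m = 1 \/ 2511 * m ^ 2 <= n)%N ->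
  exists G : 'I_n -> {ffun 'I_(m ^ 2) -> bool},
  (forall w, \sum_i `|sdot (G i) (sgn_vec R w)| <= 4 * n%:R * m%:R) /\
  (forall y, n%:R / 78 * Num.sqrt (\sum_j y j ^+ 2) <= \sum_i `|sdot (G i) y| :> R).
Proof.
move=> m0 [->|n_ge].
  exists (fun _ => [ffun => false]).
  have e y : \sum_(i < n) `|sdot ([ffun => false] : {ffun 'I_(1 ^ 2) -> bool}) y| = n%:R * `|y ord0|.
    have -> : sdot ([ffun => false] : {ffun 'I_(1 ^ 2) -> bool}) y = y ord0.
      by rewrite /sdot (big_ord_recl 0) big_ord0 ffunE expr0 mul1r addr0.
    by rewrite sumr_const card_ord mulr_natl.
  split=> [w|y]; rewrite e.
    rewrite normrX normrN1 expr1n; have : 0 <= n%:R :> R by []; lra.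
  rewrite (big_ord_recl 0) big_ord0 addr0 sqrtr_sqr -mulrA ler_wpM2l//.
  by rewrite mulrC ler_piMr//; lra.
set d := (m ^ 2)%N; set N := (78 * d)%N.
have [G [G1 G2]] := exists_sign_rows R n m m0 n_ge.
exists G; split=> // y; set t := \sum_j _.
have [t0|] := ltP 0 t; last by move=> /ler0_sqrtr ->; rewrite mulr0 sumr_ge0.
have st0 : 0 < Num.sqrt t by rewrite sqrtr_gt0.
have mR : 0 < m%:R :> R by rewrite ltr0n.
pose a : R := 78 * m%:R / Num.sqrt t.
have a0 : 0 < a by rewrite divr_gt0// mulr_gt0.
pose u j := a * y j.
have u2 : \sum_j u j ^+ 2 = 78 ^+ 2 * d%:R.
  under eq_bigr => j _ do rewrite exprMn.
  rewrite -mulr_sumr -/t /a expr_div_n sqr_sqrtr ?(ltW t0)// exprMn natrX.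
  by field; rewrite gt_eqF.
have trn j := truncn_itv (normr_ge0 (u j)).
pose k j := Num.truncn `|u j|.
have kN : (\sum_j k j <= N)%N.
  rewrite -(ler_nat R) natr_sum.
  (* [|u| <= u^2/156 + 39] restates [(|u| - 78)^2 >= 0]; the sum is [39 d + 39 d = N]. *)
  apply: (@le_trans _ _ (\sum_j (u j ^+ 2 / 156 + 39))).
    apply: ler_sum => j _; have /andP[h _] := trn j; apply: le_trans h _.
    rewrite -[u j ^+ 2]real_normK ?num_real//.
    have := sqr_ge0 (`|u j| - 78); move: `|u j| => x h; nra.
  rewrite big_split /= -mulr_suml u2 sumr_const card_ord -[39 *+ _]mulr_natr (natrM _ 78 d).
  by move: (d%:R : R) => D; lra.
have kN1 j : (k j < N.+1)%N.
  by rewrite ltnS (leq_trans _ kN)// (bigD1 j)//= leq_addr.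
pose z : {ffun 'I_d -> bool * 'I_N.+1} := [ffun j => ((u j < 0)%R, inord (k j))].
have zE j : lattice_vec R m z j = (-1) ^+ (u j < 0)%R * (k j)%:R.
  by rewrite /lattice_vec ffunE /= inordK.
have w1 j : `|u j - lattice_vec R m z j| <= 1.
  rewrite zE -{1}[u j]mulr_sign_norm -mulrBr normrM normrX normrN1 expr1n mul1r.
  have /andP[] := trn j; rewrite -/(k j) -natr1 ler_norml; lra.
have zN : (\sum_j (z j).2 <= N)%N.
  by apply: leq_trans kN; apply: leq_sum => j _; rewrite ffunE /= inordK.
have L := G2 z zN.
have U := sdot_cube R n d G _ G1 _ w1.
have s39 : 39 * m%:R <= Num.sqrt (\sum_j lattice_vec R m z j ^+ 2).
  rewrite -[leLHS]ger0_norm ?mulr_ge0// -sqrtr_sqr ler_wsqrtr// exprMn -(natrX _ m 2) -/d.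
  (* Rounding moves a coordinate by at most 1, so [z^2 >= u^2/2 - 1]; the total [(78^2/2 - 1) d]
     exceeds [39^2 d]. *)
  apply: (@le_trans _ _ (\sum_j (u j ^+ 2 / 2 - 1))).
    rewrite sumrB -mulr_suml u2 sumr_const card_ord.
    have : 0 <= d%:R :> R by [].
    by move: (d%:R : R) => D; lra.
  apply: ler_sum => j _; have := w1 j; rewrite ler_norml.
  move: (u j) (lattice_vec R m z j) => b c /andP[h1 h2].
  have : 0 <= (1 - (b - c)) * (1 + (b - c)) by apply: mulr_ge0; lra.
  by have := sqr_ge0 (2 * c - b); lra.
have T : \sum_i `|sdot (G i) (lattice_vec R m z)| - 
    \sum_i `|sdot (G i) (fun j => u j - lattice_vec R m z j)| <= 
    a * \sum_i `|sdot (G i) y|.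
  rewrite -sumrB mulr_sumr; apply: ler_sum => i _.
  have -> : a * `|sdot (G i) y| = `|sdot (G i) u|.
    by rewrite /u sdotZ normrM (gtr0_norm a0).
  by rewrite lerBlDr sdotB -lerBlDl (le_trans (lerB_dist _ _))// distrC.
(* The rounded point gives at least [4/31 * 39 n m > 5 n m], and the rounding error costs at most
   [4 n m]. *)
have nm : n%:R * m%:R <= a * \sum_i `|sdot (G i) y|.
  have : 0 <= n%:R * (Num.sqrt (\sum_j lattice_vec R m z j ^+ 2) - 39 * m%:R).
    by rewrite mulr_ge0// subr_ge0.
  have : 0 <= n%:R * m%:R :> R by rewrite mulr_ge0.
  by move=> h1 h2; lra.
rewrite -(ler_pM2l a0); apply: le_trans nm; rewrite /a le_eqVlt; apply/orP; left.
by apply/eqP; field; rewrite gt_eqF.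
Qed.

(** * Decompositions of positive semidefinite matrices *)

Local Open Scope complex_scope.

Lemma adjmxM (m n p : nat) (M : 'M[CC]_(m, n)) (N : 'M[CC]_(n, p)) :
  adjmx (M *m N) = adjmx N *m adjmx M.
Proof. by rewrite /adjmx trmx_mul map_mxM. Qed.

Lemma adjmxK (m n : nat) (M : 'M[CC]_(m, n)) : adjmx (adjmx M) = M.
Proof. by apply/matrixP => i j; rewrite !mxE conjcK. Qed.

Lemma cabs_ge0 (z : CC) : 0 <= cabs z.
Proof. by case: z => a b; rewrite /cabs /= sqrtr_ge0. Qed.

Lemma sqr_cabs (z : CC) : cabs z ^+ 2 = complex.Re z ^+ 2 + complex.Im z ^+ 2.
Proof. by case: z => a b; rewrite /cabs /= sqr_sqrtr// addr_ge0// sqr_ge0. Qed.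

Lemma Re_le_cabs (z : CC) : `|complex.Re z| <= cabs z.
Proof.
rewrite -(ger0_norm (cabs_ge0 z)) -ler_sqr ?nnegrE//.
by rewrite !real_normK ?num_real// sqr_cabs lerDl sqr_ge0.
Qed.

Lemma Im_le_cabs (z : CC) : `|complex.Im z| <= cabs z.
Proof.
rewrite -(ger0_norm (cabs_ge0 z)) -ler_sqr ?nnegrE//.
by rewrite !real_normK ?num_real// sqr_cabs lerDr sqr_ge0.
Qed.

Lemma cabs_real (a : RR) : cabs a%:C = `|a|.
Proof. by rewrite /cabs /= expr0n addr0 sqrtr_sqr. Qed.

Lemma mul_conjc (z : CC) : z * z^* = (cabs z ^+ 2)%:C.
Proof.
rewrite sqr_cabs; case: z => a b; apply/eqP; rewrite eq_complex /=.
by apply/andP; split; apply/eqP; ring.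
Qed.

Lemma Re_mxtrace_outer (n : nat) (x : 'cV[CC]_n) :
  complex.Re (\tr (x *m adjmx x)) = \sum_i cabs (x i ord0) ^+ 2.
Proof.
rewrite /mxtrace (eq_bigr (fun i => (cabs (x i ord0) ^+ 2)%:C)).
  by rewrite -(raddf_sum (real_complex RR)).
by move=> i _; rewrite mxE big_ord1 !mxE mul_conjc.
Qed.

Lemma Re_mxtrace_sum (n p : nat) (x : 'I_p -> 'cV[CC]_n) :
  complex.Re (\tr (\sum_k x k *m adjmx (x k))) = \sum_k \sum_i cabs (x k i ord0) ^+ 2.
Proof.
rewrite (raddf_sum (@mxtrace CC n)) (raddf_sum (@complex.Re RR : Rcomplex RR -> RR)).
by apply: eq_bigr => k _; exact: Re_mxtrace_outer.
Qed.

(** Cauchy-Schwarz, read off from [sum_i (n a_i - S)^2 >= 0]. *)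
Lemma sqr_sum_le (R : realFieldType) (n : nat) (a : 'I_n -> R) :
  (\sum_i a i) ^+ 2 <= n%:R * \sum_i a i ^+ 2.
Proof.
case: n a => [|n] a; first by rewrite !big_ord0 mul0r expr0n.
set S := \sum_i a i.
have n0 : 0 < n.+1%:R :> R by rewrite ltr0n.
have : 0 <= \sum_i (n.+1%:R * a i - S) ^+ 2 by apply: sumr_ge0 => i _; exact: sqr_ge0.
rewrite (eq_bigr (fun i => n.+1%:R ^+ 2 * a i ^+ 2 + (- (2 * n.+1%:R * S)) * a i + S ^+ 2));
  last by move=> i _; ring.
rewrite 2!big_split /= -!mulr_sumr -/S sumr_const card_ord -[S *+ _]mulr_natl => h.
rewrite -(ler_pM2l n0) -subr_ge0; apply: le_trans h _; rewrite le_eqVlt; apply/orP; left.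
by apply/eqP; ring.
Qed.

Lemma gamma_set_ge0 (n : nat) (A : 'M[CC]_n) t : gamma_set A t -> 0 <= t.
Proof. by move=> [p [x [_ ->]]]; apply: sumr_ge0 => k _; exact: sqr_ge0. Qed.

(** Spectral theorem: [x k] is a unit eigenvector scaled by the square root of its eigenvalue. *)
Lemma psd_decomposition (n : nat) (A : 'M[CC]_n) : psd A ->
  exists x : 'I_n -> 'cV[CC]_n, \sum_k x k *m adjmx (x k) = A.
Proof.
move=> [Aadj Apos].
have adjE (p q : nat) (M : 'M[CC]_(p, q)) : map_mx Num.conj M^T = adjmx M by [].
have /orthomx_spectralP An : A \is normalmx.
  by apply/normalmxP; rewrite adjE -Aadj.
set P := spectralmx A in An; set D := spectral_diag A in An.
have Pu : P \is unitarymx := spectral_unitarymx A.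
have PV : invmx P = adjmx P := invmx_unitary Pu.
have PAP : P *m A *m adjmx P = diag_mx D.
  by rewrite An -PV !mulmxA mulmxV ?unitarymx_unit// mul1mx mulmxK ?unitarymx_unit.
have D0 k : 0 <= D ord0 k.
  have := Apos (adjmx (row k P)); rewrite adjmxK -row_mul.
  suff -> : (row k (P *m A) *m adjmx (row k P)) ord0 ord0 = D ord0 k by [].
  transitivity ((P *m A *m adjmx P) k k); last by rewrite PAP mxE eqxx mulr1n.
  by rewrite !mxE; apply: eq_bigr => j _; rewrite !mxE.
exists (fun k => sqrtc (D ord0 k) *: adjmx (row k P)).
apply/matrixP => i j; rewrite summxE An PV mul_mx_diag mxE.
apply: eq_bigr => k _; rewrite !mxE big_ord1 !mxE rmorphM /= conjcK.
have -> : (sqrtc (D ord0 k))^* = sqrtc (D ord0 k).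
  have /ger0_Im : 0 <= sqrtc (D ord0 k) by rewrite sqrtc_ge0.
  by case: (sqrtc _) => a b /= ->; rewrite oppr0.
have -> : D 0 k = D ord0 k by [].
by rewrite -[in RHS](sqr_sqrtc (D ord0 k)); ring.
Qed.

Lemma cabs_mnorm1 (n : nat) (A : 'M[CC]_n) : complex.Re (\tr A) <= mnorm1 A.
Proof.
rewrite /mxtrace (raddf_sum (@complex.Re RR : Rcomplex RR -> RR)).
apply: ler_sum => i _; rewrite (bigD1 i)//= (le_trans (ler_norm _))//.
by rewrite (le_trans (Re_le_cabs _))// lerDl sumr_ge0// => *; exact: cabs_ge0.
Qed.

Lemma gamma_plus_le (n : nat) (A : 'M[CC]_n) : psd A -> gamma_plus A <= n%:R * mnorm1 A.
Proof.
move=> /psd_decomposition[x xA].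
apply: (@le_trans _ _ (\sum_k vnorm1 (x k) ^+ 2)).
  apply: ge_inf; first by exists 0 => t; exact: gamma_set_ge0.
  by exists n, x.
apply: (@le_trans _ _ (n%:R * complex.Re (\tr A))); last first.
  by rewrite ler_wpM2l// cabs_mnorm1.
rewrite -xA Re_mxtrace_sum mulr_sumr; apply: ler_sum => k _.
exact: sqr_sum_le.
Qed.

(** * Decompositions of [G G^T] for a section [G] *)

Lemma psd_outer (n d : nat) (M : 'M[CC]_(n, d)) : psd (M *m adjmx M).
Proof.
split=> [|x]; first by rewrite adjmxM adjmxK.
rewrite mulmxA -mulmxA; set y := adjmx M *m x.
have -> : adjmx x *m M = adjmx y by rewrite adjmxM adjmxK.
rewrite mxE; apply: sumr_ge0 => k _.
have -> : adjmx y ord0 k = (y k ord0)^* by rewrite !mxE.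
by rewrite mulrC mulcJ_ge0.
Qed.

Local Notation cmx := (map_mx (real_complex RR)).

Lemma adjmx_real (m n : nat) (M : 'M[RR]_(m, n)) : adjmx (cmx M) = cmx M^T.
Proof. by apply/matrixP => i j; rewrite !mxE conjc_real. Qed.

Section LowerBound.
Variables (n d : nat) (G : 'M[RR]_(n, d)) (c : RR).
Hypothesis c_gt0 : 0 < c.
Hypothesis G_ge : forall y : 'I_d -> RR,
  c * Num.sqrt (\sum_j y j ^+ 2) <= \sum_i `|\sum_j G i j * y j|.

(** By [G_ge], [G y = 0] forces [y = 0], so [G] has full column rank. *)
Lemma section_left_inverse : exists P : 'M[RR]_(d, n), P *m G = 1%:M.
Proof.
have /row_freeP[B GB] : row_free G^T.
  apply: inj_row_free => v vG.
  have s0 : \sum_j v ord0 j ^+ 2 = 0.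
    apply/eqP; rewrite eq_le sumr_ge0 ?andbT => [|j _]; last exact: sqr_ge0.
    have := G_ge (v ord0); rewrite [leRHS]big1 => [|i _].
      by rewrite pmulr_rle0// => h; rewrite -sqrtr_eq0 eq_le h sqrtr_ge0.
    have := congr1 (fun M : 'rV_n => M ord0 i) vG; rewrite !mxE => e.
    rewrite (_ : \sum_j _ = 0) ?normr0// -[RHS]e.
    by apply: eq_bigr => j _; rewrite mxE mulrC.
  apply/rowP => j; rewrite mxE; apply/eqP; rewrite -sqrf_eq0; apply/eqP.
  by apply: (psumr_eq0P _ s0) => // i _; exact: sqr_ge0.
by exists B^T; apply: trmx_inj; rewrite trmx_mul trmxK GB trmx1.
Qed.

(* Applying the hypothesis to the real and imaginary parts of [y] costs a factor 2. *)
Lemma vnorm1_section (y : 'cV[CC]_d) :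
  c ^+ 2 / 2 * \sum_j cabs (y j ord0) ^+ 2 <= vnorm1 (cmx G *m y) ^+ 2.
Proof.
have rc (z w : CC) (a : RR) : complex.Re (a%:C * z) = a * complex.Re z /\
    complex.Im (a%:C * z) = a * complex.Im z.
  by case: z => p q /=; split; ring.
(* [f] stands for [Re] or [Im]: real-linear and dominated by the modulus. *)
have part (f : CC -> RR) : {morph f : z w / z + w} -> f 0 = 0 ->
    (forall (a : RR) z, f (a%:C * z) = a * f z) -> (forall z, `|f z| <= cabs z) ->
    c ^+ 2 * \sum_j f (y j ord0) ^+ 2 <= vnorm1 (cmx G *m y) ^+ 2.
  move=> fD f0 fZ fn; have S0 : 0 <= \sum_j f (y j ord0) ^+ 2.
    by apply: sumr_ge0 => j _; exact: sqr_ge0.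
  rewrite -[X in _ * X]sqr_sqrtr// -exprMn ler_sqr ?nnegrE; last first.
  - by apply: sumr_ge0 => i _; exact: cabs_ge0.
  - by rewrite mulr_ge0 ?sqrtr_ge0// ltW.
  apply: le_trans (G_ge (fun j => f (y j ord0))) _.
  apply: ler_sum => i _; apply: le_trans (fn _).
  rewrite le_eqVlt; apply/orP; left; apply/eqP; congr Num.norm.
  rewrite mxE (big_morph f fD f0); apply: eq_bigr => j _.
  by rewrite mxE fZ.
have := part (@complex.Re RR) _ _ _ Re_le_cabs.
have := part (@complex.Im RR) _ _ _ Im_le_cabs.
move=> /(_ ltac:(by case=> ? ? [? ?]) erefl (fun a z => (rc z 0 a).2)) hI.
move=> /(_ ltac:(by case=> ? ? [? ?]) erefl (fun a z => (rc z 0 a).1)) hR.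
under eq_bigr => j _ do rewrite sqr_cabs.
by rewrite big_split /=; lra.
Qed.

Lemma gamma_set_section (t : RR) :
  gamma_set (cmx (G *m G^T)) t -> c ^+ 2 * d%:R / 2 <= t.
Proof.
move=> [p [x [xA ->]]]; have [P PG] := section_left_inverse.
have conj_outer (q : nat) (Q : 'M[CC]_(q, n)) :
    \sum_k (Q *m x k) *m adjmx (Q *m x k) = (Q *m cmx G) *m adjmx (Q *m cmx G).
  under eq_bigr => k _ do rewrite adjmxM mulmxA -[Q *m x k *m _]mulmxA.
  by rewrite -mulmx_suml -mulmx_sumr xA map_mxM -adjmx_real adjmxM !mulmxA.
pose y k := cmx P *m x k.
have PGc : cmx P *m cmx G = 1%:M by rewrite -map_mxM PG map_mx1.
have xE k : x k = cmx G *m y k.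
  (* [Q] kills the range of [G], so the squared lengths of the [Q x_k] sum to the trace of
     [Q A Q^* = 0]; hence [x_k = G P x_k]. *)
  pose Q : 'M[CC]_n := 1%:M - cmx G *m cmx P.
  have QG : Q *m cmx G = 0 by rewrite mulmxBl mul1mx -mulmxA PGc mulmx1 subrr.
  have /esym/eqP := Re_mxtrace_sum _ _ (fun k => Q *m x k).
  rewrite conj_outer QG mul0mx mxtrace0 /= => /eqP s0.
  have s1 : \sum_i cabs ((Q *m x k) i ord0) ^+ 2 = 0.
    move: s0 => /psumr_eq0P; apply=> // l _; apply: sumr_ge0 => *; exact: sqr_ge0.
  have s2 i : cabs ((Q *m x k) i ord0) ^+ 2 = 0.
    by move: s1 => /psumr_eq0P; apply=> // l _; exact: sqr_ge0.
  have : Q *m x k = 0.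
    apply/colP => i; rewrite [RHS]mxE; apply: Normc.eq0_normc; apply/eqP.
    by rewrite -sqrf_eq0; apply/eqP/s2.
  by rewrite mulmxBl mul1mx -mulmxA => /eqP; rewrite subr_eq0 => /eqP.
have tr1 : \sum_k \sum_j cabs (y k j ord0) ^+ 2 = d%:R.
  rewrite -Re_mxtrace_sum conj_outer PGc mul1mx.
  have -> : adjmx 1%:M = 1%:M :> 'M[CC]_d.
    by rewrite -(map_mx1 (real_complex RR)) adjmx_real trmx1.
  by rewrite mxtrace1 -(rmorph_nat (real_complex RR)).
rewrite -tr1 mulrAC mulr_sumr; apply: ler_sum => k _.
by rewrite [in leRHS]xE; exact: vnorm1_section.
Qed.

End LowerBound.

(** * Matrices with large quotient, the choice of [m], and the two bounds *)

Lemma exists_psd_large_gamma (n m : nat) : (0 < n)%N -> (0 < m)%N ->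
  (m = 1 \/ 2511 * m ^ 2 <= n)%N ->
  exists A : 'M[CC]_n, [/\ psd A, A <> 0 & m%:R / (8 * 78 ^+ 2) <= gamma_plus A / mnorm1 A].
Proof.
move=> n0 m0 mn; have [r [r_le r_ge]] := @exists_sign_section RR n m m0 mn.
have nR : 0 < n%:R :> RR by rewrite ltr0n.
have mR : 0 < m%:R :> RR by rewrite ltr0n.
set d := (m ^ 2)%N in r r_le r_ge.
pose G : 'M[RR]_(n, d) := \matrix_(i, j) (-1) ^+ r i j.
have sdotE i (y : 'I_d -> RR) : \sum_j G i j * y j = sdot (r i) y.
  by apply: eq_bigr => j _; rewrite mxE.
have c0 : 0 < n%:R / 78 :> RR by rewrite divr_gt0.
have G_ge y : n%:R / 78 * Num.sqrt (\sum_j y j ^+ 2) <= \sum_i `|\sum_j G i j * y j|.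
  by under [leRHS]eq_bigr => i _ do rewrite sdotE; exact: r_ge.
pose A := cmx (G *m G^T).
have Apsd : psd A by rewrite /A map_mxM -adjmx_real; exact: psd_outer.
have gA : (n%:R / 78) ^+ 2 * d%:R / 2 <= gamma_plus A.
  apply: lb_le_inf => [|t]; last exact: gamma_set_section c0 G_ge t.
  (* The [inf] of an empty set is 0 by default, so a decomposition must be exhibited. *)
  have [x xA] := psd_decomposition _ _ Apsd.
  by exists (\sum_k vnorm1 (x k) ^+ 2); exists n, x.
have nA : mnorm1 A <= n%:R * (4 * n%:R * m%:R).
  apply: (@le_trans _ _ (\sum_(i < n) (4 * n%:R * m%:R))); last first.
    by rewrite sumr_const card_ord -[leLHS]mulr_natl.
  (* Row [i] of [A] is [G] applied to row [i] of [G], a vertex of the cube. *)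
  apply: ler_sum => i _; apply: le_trans (r_le (r i)).
  apply: ler_sum => j _; rewrite mxE cabs_real mxE -sdotE le_eqVlt; apply/orP; left.
  by apply/eqP; congr Num.norm; apply: eq_bigr => k _; rewrite !mxE mulrC.
have g0 : 0 < gamma_plus A.
  by apply: lt_le_trans gA; rewrite divr_gt0// mulr_gt0 ?exprn_gt0// ltr0n expn_gt0 m0.
(* The upper bound on [gamma_plus] transfers its positivity to the norm. *)
have A0 : 0 < mnorm1 A.
  by have := lt_le_trans g0 (gamma_plus_le _ _ Apsd); rewrite pmulr_rgt0.
exists A; split=> //.
- move=> Az; move: A0; rewrite Az /mnorm1 big1 ?ltxx// => i _; rewrite big1// => j _.
  by rewrite mxE -[0]/(0%:C) cabs_real normr0.
- rewrite ler_pdivlMr//; apply: le_trans gA.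
  apply: (@le_trans _ _ (m%:R / (8 * 78 ^+ 2) * (n%:R * (4 * n%:R * m%:R)))).
    by rewrite ler_wpM2l// divr_ge0.
  by rewrite natrX le_eqVlt; apply/orP; left; apply/eqP; field.
Qed.

(** For the largest admissible [m], failure at [m + 1] gives [n < 2511 (m + 1)^2 <= 10044 m^2 <=
    (101 m)^2]. *)
Lemma exists_scale (n : nat) : exists m : nat,
  [/\ (0 < m)%N, (m = 1 \/ 2511 * m ^ 2 <= n)%N & (n <= (101 * m) ^ 2)%N].
Proof.
pose P m := (0 < m)%N && ((m == 1) || (2511 * m ^ 2 <= n))%N.
(* The search bound [n.+1] admits [m = 1] even at [n = 0]. *)
have [] := @ex_maxnP P n.+1; first by exists 1%N.
  by move=> m /andP[m0 /orP[/eqP ->|]] //; nia.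
move=> m /andP[m0 mP] mmax; exists m; split=> //.
  by case/orP: mP => [/eqP|]; [left|right].
rewrite leqNgt; apply/negP => h.
have : P m.+1 by rewrite /P /=; apply/orP; right; nia.
by move=> /mmax; rewrite ltnn.
Qed.

Theorem theorem1 :
  exists c : RR, 0 < c /\
    forall n : nat, (0 < n)%N ->
      ((c * Num.sqrt (n%:R : RR))%:E <= Cn n)%E /\ (Cn n <= (n%:R : RR)%:E)%E.
Proof.
(* The quotient is at least [m / (8 * 78^2)], and [sqrt n <= 101 m]. *)
exists ((8 * 78 ^+ 2)^-1 / 101); split=> [|n n0]; first by rewrite divr_gt0// invr_gt0.
split.
- have [m [m0 mn nm]] := exists_scale n.
  have [A [Apsd A0 gA]] := exists_psd_large_gamma n m n0 m0 mn.
  apply: (@le_trans _ _ (gamma_plus A / mnorm1 A)%:E); last first.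
    by apply: ereal_sup_ubound; exists A.
  rewrite lee_fin; apply: le_trans gA.
  have : Num.sqrt n%:R <= 101 * m%:R :> RR.
    rewrite -[leRHS]ger0_norm ?mulr_ge0// -sqrtr_sqr ler_wsqrtr//.
    by rewrite -natrM -natrX ler_nat.
  by move=> h; lra.
- apply: ge_ereal_sup => _ [A [Apsd A0] <-]; rewrite lee_fin.
  have : 0 <= mnorm1 A.
    by apply: sumr_ge0 => i _; apply: sumr_ge0 => j _; exact: cabs_ge0.
  (* If the norm is zero, the quotient is 0 by the convention [0^-1 = 0]. *)
  rewrite le_eqVlt => /orP[/eqP <-|A1]; first by rewrite invr0 mulr0.
  by rewrite ler_pdivrMr// gamma_plus_le.
Qed.
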